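(* Let $N\ge 2$, let $I\subset(0,\infty)$ be an open interval, let $a,b$ be two positive differentiable functions on $I$, and put $c=b/a$. Let $\varepsilon\in\{1,-1\}$ and let $q>0$, $q\neq 1$. Consider on $I\times\mathbb{S}^{N-1}$ (equivalently on the rotationally symmetric domain $\Omega=\{r\sigma:\ r\in I,\ \sigma\in \mathbb{S}^{N-1}\}\subset\mathbb{R}^N$) the equation $$\Delta^g u=\varepsilon u|u|^{q-1}. \qquad (E)$$ Then (E) admits a non-radial pseudo-radial solution if and only if there exists $\mu\in\mathbb{R}$ such that both of the following hold: (i) on $I$, $$c^2\left(b^{\frac{2}{1-q}}\right)''+(N-1)\,c\,c'\left(b^{\frac{2}{1-q}}\right)'=\mu\, b^{\frac{2}{1-q}};$$ (ii) the equation $$\Delta_{\mathbb{S}^{N-1}}w+\mu w=\varepsilon w|w|^{q-1}$$ admits a nonconstant solution $w$ on $\mathbb{S}^{N-1}$. Moreover, when (i) and (ii) are satisfied, any non-radial pseudo-radial solution of (E) is of the form $u(r,\sigma)=b^{\frac{2}{1-q}}(r)\,w(\sigma)$, where $w$ is a nonconstant solution on $\mathbb{S}^{N-1}$ of the equation in (ii).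
   Context: The metric is $g=a^2(r)\,dr^2+b^2(r)\,d\sigma^2$ on $I\times\mathbb{S}^{N-1}$, where $d\sigma^2$ is the standard metric of the unit sphere. The operator $\Delta^g$ is $$\Delta^g=\frac{1}{b^2}\left[c^2\frac{\partial^2}{\partial r^2}+(N-1)\,c\,c'\frac{\partial}{\partial r}+\Delta_{\mathbb{S}^{N-1}}\right],\qquad c=\frac{b}{a},$$ where $\Delta_{\mathbb{S}^{N-1}}$ is the Laplace-Beltrami operator of the standard sphere (for $N=2$, $\Delta_{\mathbb{S}^1}=d^2/d\theta^2$ acting on $2\pi$-periodic functions). Solutions are real-valued classical solutions. A solution $u$ is pseudo-radial if it can be written $u(r,\sigma)=h(r)w(\sigma)$ for some functions $h$ on $I$ and $w$ on $\mathbb{S}^{N-1}$; it is radial if it does not depend on $\sigma$, and non-radial otherwise. *)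

(* Defs.v *)
From mathcomp Require Import all_boot all_order all_algebra.
From mathcomp Require Import all_classical all_reals all_analysis.

Set Implicit Arguments.
Unset Strict Implicit.
Unset Printing Implicit Defensive.

Import Order.TTheory GRing.Theory Num.Theory.
Import numFieldNormedType.Exports.

Local Open Scope classical_set_scope.
Local Open Scope ring_scope.

(* The canonical norm on 'rV[R]_N is the sup norm. It induces the usual topology
   and differentiability of R^N, but the unit sphere needs the Euclidean norm. *)
Definition enorm (R : realType) (N : nat) (x : 'rV[R]_N) : R :=
  Num.sqrt (\sum_(i < N) x 0 i ^+ 2).

(* S^{N-1} as a subset of R^N. A function on the sphere is represented by a
   total function on 'rV[R]_N; every notion below depends only on the values
   taken on the sphere. *)
Definition sphere (R : realType) (N : nat) : set 'rV[R]_N :=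
  [set x | enorm x = 1].

(* The projection x |-> x / |x| of R^N \ {0} onto the sphere. *)
Definition sproj (R : realType) (N : nat) (x : 'rV[R]_N) : 'rV[R]_N :=
  (enorm x)^-1 *: x.

(* Class C^2 on an open set D: f and all its directional derivatives are
   Frechet-differentiable on D, and the second derivatives are continuous. *)
Definition C2_on (R : realType) (V : normedModType R) (D : set V)
    (f : V -> R) : Prop :=
  [/\ forall x, D x -> differentiable f x,
      forall v x, D x -> differentiable ('D_v f) x
    & forall v w x, D x -> {for x, continuous ('D_w ('D_v f))}].

(* C^2 regularity on the sphere and on I x S^{N-1} is tested on R^N \ {0} and on
   {x | |x| \in I}, through the retraction sproj and through the
   diffeomorphism x |-> (|x|, x / |x|) onto I x S^{N-1} respectively. *)
Definition sphere_C2 (R : realType) (N : nat) (w : 'rV[R]_N -> R) : Prop :=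
  C2_on [set x : 'rV[R]_N | x != 0] (w \o @sproj R N).

Definition cylinder_C2 (R : realType) (N : nat) (I : set R)
    (u : R -> 'rV[R]_N -> R) : Prop :=
  C2_on [set x : 'rV[R]_N | I (enorm x)] (fun x => u (enorm x) (sproj x)).

(* Laplace-Beltrami operator of the unit sphere with the metric induced by R^N,
   as the divergence of the gradient. At a point s of the sphere, the Euclidean
   gradient of w \o sproj is tangent to the sphere and is the Riemannian gradient
   of w; for a tangent field X, the trace of the differential of X \o sproj is the
   Riemannian divergence of X. Both are meaningful at points of the sphere only. *)
Definition sphere_grad (R : realType) (N : nat) (w : 'rV[R]_N -> R)
    (s : 'rV[R]_N) : 'rV[R]_N :=
  \row_(i < N) 'D_(delta_mx 0 i) (w \o @sproj R N) s.

Definition sphere_div (R : realType) (N : nat) (X : 'rV[R]_N -> 'rV[R]_N)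
    (s : 'rV[R]_N) : R :=
  \sum_(i < N) 'D_(delta_mx 0 i) (fun x => X (sproj x) 0 i) s.

Definition sphere_laplacian (R : realType) (N : nat) (w : 'rV[R]_N -> R) :
    'rV[R]_N -> R :=
  sphere_div (sphere_grad w).

(* z |z|^(q-1). With the library's total powR this vanishes at z = 0 for every
   q, which is the intended value when q > 0. *)
Definition signed_pow (R : realType) (q z : R) : R := z * `|z| `^ (q - 1).

(* The Laplace-Beltrami operator of a(r)^2 dr^2 + b(r)^2 dsigma^2. *)
Definition metric_laplacian (R : realType) (N : nat) (a b : R -> R)
    (u : R -> 'rV[R]_N -> R) (r : R) (s : 'rV[R]_N) : R :=
  let c := fun t => b t / a t in
  (b r ^+ 2)^-1 *
    (c r ^+ 2 * (fun t => u t s)^`(2)%classic r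
     + (N%:R - 1) * c r * c^`()%classic r * (fun t => u t s)^`()%classic r
     + sphere_laplacian (u r) s).

Definition solves_E (R : realType) (N : nat) (I : set R) (a b : R -> R)
    (eps q : R) (u : R -> 'rV[R]_N -> R) : Prop :=
  cylinder_C2 I u /\
  forall r s, I r -> sphere s ->
    metric_laplacian a b u r s = eps * signed_pow q (u r s).

Definition pseudo_radial (R : realType) (N : nat) (I : set R)
    (u : R -> 'rV[R]_N -> R) : Prop :=
  exists (h : R -> R) (w : 'rV[R]_N -> R),
    forall r s, I r -> sphere s -> u r s = h r * w s.

Definition radial (R : realType) (N : nat) (I : set R)
    (u : R -> 'rV[R]_N -> R) : Prop :=
  forall r s t, I r -> sphere s -> sphere t -> u r s = u r t.

(* Classical (C^2) solution of c^2 f'' + (N-1) c c' f' = mu f on I. *)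
Definition solves_radial_ode (R : realType) (N : nat) (I : set R)
    (c : R -> R) (mu : R) (f : R -> R) : Prop :=
  C2_on (V := R^o) I f /\
  forall r, I r ->
    c r ^+ 2 * f^`(2)%classic r + (N%:R - 1) * c r * c^`()%classic r * f^`()%classic r
      = mu * f r.

Definition solves_sphere (R : realType) (N : nat) (eps q mu : R)
    (w : 'rV[R]_N -> R) : Prop :=
  sphere_C2 w /\
  forall s, sphere s ->
    sphere_laplacian w s + mu * w s = eps * signed_pow q (w s).

Definition nonconstant_on_sphere (R : realType) (N : nat)
    (w : 'rV[R]_N -> R) : Prop :=
  exists s t, [/\ sphere s, sphere t & w s != w t].

(* Main.v *)
Require Import Defs.
From mathcomp Require Import all_boot all_order all_algebra.
From mathcomp Require Import ring lra.
From mathcomp Require Import all_classical all_reals all_analysis.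
Import Order.TTheory GRing.Theory Num.Theory.
Import numFieldNormedType.Exports.
Local Open Scope classical_set_scope.
Local Open Scope ring_scope.

(* Let u = h w be a non-radial solution and L = c^2 d^2/dr^2 + (N-1) c c' d/dr.
   Where h does not vanish, the equation divided by h reads
     Delta w = eps (b^2 |h|^(q-1)) w |w|^(q-1) - (L h / h) w.
   If the coefficient b^2 |h|^(q-1) took two values, |w| would take at most one
   nonzero value and the continuous function w would be constant on the connected
   sphere. So both coefficients are constant on {h != 0}: there h / b^(2/(1-q))
   has constant modulus, hence by connectedness of I it is a nonzero constant on
   the whole of I, and mu is the constant L h / h. *)

Set Implicit Arguments.
Unset Strict Implicit.

(** * Calculus of functions of class C^1 and C^2 *)

(** An expansion of [f] at [x] with remainder o(h) is also one of [g], and [diff_unique] then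
    identifies the linear map ['d f x] with the differential of [g]. *)
Lemma near_eq_differentiable (R : numFieldType) (V W : normedModType R)
    (f g : V -> W) (x : V) :
  (\near x, f x = g x) -> differentiable f x -> differentiable g x.
Proof.
move=> fg df; have fgx : f x = g x by exact: (nbhs_singleton fg).
have dg : g \o shift x = cst (g x) + 'd f x +o_ 0 id.
  apply/eqaddoP => _/posnumP[e]; rewrite -fgx.
  have /eqaddoP/(_ _ (gt0 e)) := diff_locally df.
  have fg0 : \forall h \near 0, f (h + x) = g (h + x).
    by move: fg; rewrite (near_shift 0) subr0.
  by apply: filterS2 fg0 => h /= fgh; rewrite !fctE /= fgh.
have dfc := diff_continuous df.
by apply/diff_locallyP; rewrite (diff_unique dfc dg).
Qed.

Lemma near_eq_continuous_at (T U : topologicalType) (f g : T -> U) (x : T) :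
  (\near x, f x = g x) -> {for x, continuous f} -> {for x, continuous g}.
Proof.
move=> fg cf; rewrite /prop_for /continuous_at -(nbhs_singleton fg).
exact: cvg_trans (near_eq_cvg fg) cf.
Qed.

Definition C1_on (R : realType) (V : normedModType R) (D : set V)
    (f : V -> R) : Prop :=
  (forall x, D x -> differentiable f x) /\
  forall v x, D x -> {for x, continuous ('D_v f)}.

Section C1.
Context {R : realType} {V : normedModType R}.
Implicit Types (D E : set V) (f g : V -> R).

(** This form reduces closure of C^2 under an operation to its derivative formula and the C^1
    case. *)
Lemma C2_onE D f : C2_on D f <->
  (forall x, D x -> differentiable f x) /\ forall v, C1_on D ('D_v f).
Proof.
split=> [[d1 d2 d3]|[d1 d2]].
  by split => // v; split; [exact: d2|exact: d3].
by split=> // [v x Dx|v w x Dx]; [apply: (d2 v).1|apply: (d2 v).2].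
Qed.

Lemma C2_on_C1 D f : C2_on D f -> C1_on D f.
Proof.
by case=> d1 d2 _; split=> // v x Dx; exact/differentiable_continuous/d2.
Qed.

(** Derivatives are those of total functions, so every clause of [C2_on] concerns one point at a
    time. *)
Lemma C2_on_local D f :
  (forall x, D x -> exists2 E : set V, E x & C2_on E f) -> C2_on D f.
Proof.
move=> loc; split=> [x|v x|v w x] /loc[E Ex [d1 d2 d3]].
- exact: d1.
- exact: d2.
- exact: d3.
Qed.

Lemma C2_on_subset D E f : D `<=` E -> C2_on E f -> C2_on D f.
Proof. by move=> DE fE; apply: C2_on_local => x /DE Ex; exists E. Qed.

Section open_domain.
Variables (D : set V) (oD : open D).

Lemma near_open f g x : D x -> {in D, f =1 g} -> \near x, f x = g x.
Proof.
move=> Dx fg; near=> y; apply: fg; rewrite inE.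
by near: y; exact: open_nbhs_nbhs.
Unshelve. all: by end_near. Qed.

Lemma eq_C1_on f g : {in D, f =1 g} -> C1_on D f -> C1_on D g.
Proof.
move=> fg [d1 c1]; split=> [x Dx|v x Dx].
  by apply: near_eq_differentiable (d1 _ Dx); exact: near_open.
have e : \near x, 'D_v f x = 'D_v g x.
  apply: near_open => // y; rewrite inE => Dy.
  by apply: near_eq_derive; exact: near_open.
exact: near_eq_continuous_at e (c1 v x Dx).
Qed.

Lemma eq_C2_on f g : {in D, f =1 g} -> C2_on D f -> C2_on D g.
Proof.
move=> fg /C2_onE[d1 d2]; apply/C2_onE; split=> [x Dx|v].
  by apply: near_eq_differentiable (d1 _ Dx); exact: near_open.
apply: eq_C1_on (d2 v) => x; rewrite inE => Dx.
by apply: near_eq_derive; exact: near_open.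
Qed.

Lemma C1_onD f g : C1_on D f -> C1_on D g -> C1_on D (f + g).
Proof.
move=> [df cf] [dg cg]; split=> [x Dx|v x Dx].
  by apply: differentiableD; [exact: df|exact: dg].
have e : \near x, ('D_v f + 'D_v g) x = 'D_v (f + g) x.
  apply: near_open => // y; rewrite inE => Dy.
  by rewrite deriveD //; apply: diff_derivable; [exact: df|exact: dg].
apply: near_eq_continuous_at e _.
by apply: continuousD; [exact: cf|exact: cg].
Qed.

Lemma C1_onM f g : C1_on D f -> C1_on D g -> C1_on D (f * g).
Proof.
move=> [df cf] [dg cg]; split=> [x Dx|v x Dx].
  by apply: differentiableM; [exact: df|exact: dg].
have e : \near x, (f * 'D_v g + g * 'D_v f) x = 'D_v (f * g) x.
  apply: near_open => // y; rewrite inE => Dy.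
  by rewrite deriveM //; apply: diff_derivable; [exact: df|exact: dg].
apply: near_eq_continuous_at e _.
apply: continuousD; apply: continuousM.
- exact/differentiable_continuous/df.
- exact: cg.
- exact/differentiable_continuous/dg.
- exact: cf.
Qed.

Lemma C2_onD f g : C2_on D f -> C2_on D g -> C2_on D (f + g).
Proof.
move=> /C2_onE[df d2f] /C2_onE[dg d2g]; apply/C2_onE; split=> [x Dx|v].
  by apply: differentiableD; [exact: df|exact: dg].
apply: (@eq_C1_on ('D_v f + 'D_v g)); last exact: C1_onD.
move=> y; rewrite inE => Dy.
by rewrite deriveD //; apply: diff_derivable; [exact: df|exact: dg].
Qed.

(** By the Leibniz formula, each directional derivative is a sum of products of C^1 functions. *)
Lemma C2_onM f g : C2_on D f -> C2_on D g -> C2_on D (f * g).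
Proof.
move=> Cf Cg; have [Cf1 Cg1] := (C2_on_C1 Cf, C2_on_C1 Cg).
move: Cf Cg => /C2_onE[df d2f] /C2_onE[dg d2g]; apply/C2_onE; split=> [x Dx|v].
  by apply: differentiableM; [exact: df|exact: dg].
apply: (@eq_C1_on (f * 'D_v g + g * 'D_v f)).
  move=> y; rewrite inE => Dy.
  by rewrite deriveM //; apply: diff_derivable; [exact: df|exact: dg].
exact: (C1_onD (C1_onM Cf1 (d2g v)) (C1_onM Cg1 (d2f v))).
Qed.

End open_domain.

Lemma C1_on_cst D (k : R) : C1_on D (cst k).
Proof.
split=> [x _|v x _]; first exact: differentiable_cst.
rewrite (_ : 'D_v (cst k) = cst 0); first exact: cst_continuous.
by apply/funext => y; rewrite derive_cst.
Qed.

Lemma C2_on_cst D (k : R) : C2_on D (cst k).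
Proof.
apply/C2_onE; split=> [x _|v]; first exact: differentiable_cst.
rewrite (_ : 'D_v (cst k) = cst 0); first exact: C1_on_cst.
by apply/funext => y; rewrite derive_cst.
Qed.

End C1.

(** * Chain rule for a real function applied to a scalar field *)

Section scalar_postcomposition.
Context {R : realType} {V : normedModType R}.
Variables (D : set V) (oD : open D).
Implicit Type f : V -> R.

Lemma derive_comp1 (g : R -> R) f v x : differentiable f x ->
  differentiable (g : R^o -> R) (f x) ->
  'D_v (g \o f) x = 'D_1 (g : R^o -> R) (f x) * 'D_v f x.
Proof.
move=> df dg; rewrite deriveE; last exact: differentiable_comp.
rewrite diff_comp //= !deriveE // -[X in 'd g _ X]mulr1.
by rewrite [LHS]linearZ mulrC.
Qed.

Lemma C1_on_comp (J : set R) (g : R -> R) f : (forall x, D x -> J (f x)) ->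
  C1_on (V := R^o) J g -> C1_on D f -> C1_on D (g \o f).
Proof.
move=> DJ [dg cg] [df cf]; split=> [x Dx|v x Dx].
  by apply: differentiable_comp; [exact: df|exact/dg/DJ].
have e : \near x, (('D_1 (g : R^o -> R) \o f) * 'D_v f) x = 'D_v (g \o f) x.
  apply: (near_open oD) => // y; rewrite inE => Dy.
  by rewrite derive_comp1 //; [exact: df|exact/dg/DJ].
apply: near_eq_continuous_at e _.
apply: continuousM; last exact: cf.
apply: continuous_comp; last exact/cg/DJ.
exact/differentiable_continuous/df.
Qed.

Lemma C2_on_comp (J : set R) (g : R -> R) f : (forall x, D x -> J (f x)) ->
  C2_on (V := R^o) J g -> C2_on D f -> C2_on D (g \o f).
Proof.
move=> DJ Cg Cf; have Cf1 := C2_on_C1 Cf.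
move: Cf Cg => /C2_onE[df d2f] /C2_onE[dg d2g]; apply/C2_onE; split=> [x Dx|v].
  by apply: differentiable_comp; [exact: df|exact/dg/DJ].
apply: (@eq_C1_on _ _ _ oD (('D_1 (g : R^o -> R) \o f) * 'D_v f)).
  by move=> y; rewrite inE => Dy; rewrite derive_comp1 //; [exact: df|exact/dg/DJ].
have Cg1 := C1_on_comp DJ (d2g 1) Cf1.
exact: (C1_onM oD Cg1 (d2f v)).
Qed.

End scalar_postcomposition.

(** * Chain rule along a continuous linear map, given as a map that is its own differential *)

Section linear_precomposition.
Context {R : realType} {U V : normedModType R}.
Variables (L : U -> V) (dL : forall x, is_diff x L L).

Lemma derive_comp_linear (f : V -> R) v x : differentiable f (L x) ->
  'D_v (f \o L) x = 'D_(L v) f (L x).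
Proof.
move=> df; have dLx : differentiable L x by have := dL x.
rewrite !deriveE //; last exact: differentiable_comp.
by rewrite diff_comp //= diff_val.
Qed.

(** Serves for two linear maps: the ray [r |-> r *: s], which isolates the radial variable, and the
    dilations, which move a point to a prescribed radius. *)
Lemma C2_on_comp_linear (D : set V) (f : V -> R) : open D ->
  C2_on D f -> C2_on (L @^-1` D) (f \o L).
Proof.
move=> oD [d1 d2 d3].
have dLx x : differentiable L x by have := dL x.
have oE : open (L @^-1` D).
  by apply: open_comp => // x _; exact: differentiable_continuous.
have e v : {in L @^-1` D, 'D_v (f \o L) =1 'D_(L v) f \o L}.
  by move=> x; rewrite inE => Dx; apply: derive_comp_linear; exact: d1.
apply/C2_onE; split=> [x Dx|v]; first exact/differentiable_comp/d1.
apply: (@eq_C1_on _ _ _ oE ('D_(L v) f \o L)); first by move=> x /e.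
split=> [x Dx|w x Dx]; first exact/differentiable_comp/d2.
have e' : \near x, ('D_(L w) ('D_(L v) f) \o L) x = 'D_w ('D_(L v) f \o L) x.
  refine (near_open oE Dx _) => y; rewrite inE => Dy.
  by rewrite derive_comp_linear //; exact: d2.
apply: near_eq_continuous_at e' _.
by apply: continuous_comp; [exact: differentiable_continuous|exact: d3].
Qed.

End linear_precomposition.

(** * Real powers of positive functions *)

Section powers.
Context {R : realType}.
Implicit Types (p v x : R).

Let open_gt0 : open [set x : R^o | 0 < x].
Proof. exact: open_gt. Qed.

Lemma derive_scale1 (f : R^o -> R) v x : differentiable f x ->
  'D_v f x = v * 'D_1 f x.
Proof.
by move=> df; rewrite !deriveE // -[X in 'd f _ X]mulr1 [LHS]linearZ.
Qed.

Lemma differentiable_powR p x : 0 < x ->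
  differentiable (fun x : R^o => x `^ p) x.
Proof.
move=> x0; apply/derivable1_diffP.
by apply: derivable_powR; rewrite in_itv/= andbT.
Qed.

Lemma derive_powR p v x : 0 < x ->
  'D_v (fun x : R^o => x `^ p) x = (v * p) * x `^ (p - 1).
Proof.
move=> x0; rewrite derive_scale1; last exact: differentiable_powR.
have [_ ->] := is_derive1_powR p x0; exact: mulrA.
Qed.

Lemma C1_on_powR p : C1_on (V := R^o) [set x | 0 < x] (fun x => x `^ p).
Proof.
split=> [x|v x] x0; first exact: differentiable_powR.
have e : \near x, (v * p) * x `^ (p - 1)
                  = 'D_v (fun x : R^o => x `^ p) x.
  refine (near_open open_gt0 x0 _) => y; rewrite inE => y0.
  by rewrite derive_powR.
apply: near_eq_continuous_at e _.
apply: continuousM; first exact: cst_continuous.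
exact/differentiable_continuous/differentiable_powR.
Qed.

(** The derivative is a multiple of the power with exponent [p - 1], to which the C^1 case
    applies. *)
Lemma C2_on_powR_id p : C2_on (V := R^o) [set x | 0 < x] (fun x => x `^ p).
Proof.
apply/C2_onE; split=> [x|v]; first exact: differentiable_powR.
apply: (@eq_C1_on _ _ _ open_gt0 (cst (v * p) * (fun x => x `^ (p - 1)))).
  by move=> x; rewrite inE => x0; rewrite derive_powR.
exact: (C1_onM open_gt0 (C1_on_cst _ _) (C1_on_powR _)).
Qed.

Lemma C2_on_powR (V : normedModType R) (D : set V) (f : V -> R) p : open D ->
  (forall y, D y -> 0 < f y) -> C2_on D f -> C2_on D (fun y => f y `^ p).
Proof. by move=> oD f0; apply: (C2_on_comp oD f0 (C2_on_powR_id p)). Qed.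

End powers.

(** * The Euclidean norm and the radial projection *)

Section euclidean_norm.
Context {R : realType} {N : nat}.
Implicit Types x s t : 'rV[R]_N.

Lemma C2_on_coord (D : set 'rV[R]_N) (i : 'I_N) :
  C2_on D (fun x : 'rV[R]_N => x 0 i).
Proof.
have dc x : differentiable (fun x : 'rV[R]_N => x 0 i : R) x.
  exact: differentiable_coord.
apply/C2_onE; split=> [x _|v]; first exact: dc.
rewrite (_ : 'D_v _ = cst (v 0 i)); first exact: C1_on_cst.
apply/funext => x.
have := derive_id x v; rewrite derive_mx; last exact: derivable_id.
by move=> /matrixP/(_ 0 i); rewrite mxE.
Qed.

Lemma C2_on_sum_sqr (D : set 'rV[R]_N) (oD : open D) :
  C2_on D (fun x => \sum_(i < N) x 0 i ^+ 2).
Proof.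
elim: (index_enum _) => [|i r IH].
  rewrite (_ : (fun _ => _) = cst 0); first exact: C2_on_cst.
  by apply/funext => x; rewrite big_nil.
have Ci := C2_on_coord D i.
have := C2_onD oD (C2_onM oD Ci Ci) IH.
by congr C2_on; apply/funext => x; rewrite big_cons expr2 !fctE.
Qed.

Lemma sum_sqr_ge0 x : 0 <= \sum_(i < N) x 0 i ^+ 2.
Proof. by apply: sumr_ge0 => i _; exact: sqr_ge0. Qed.

Lemma enorm_continuous : continuous (@enorm R N).
Proof.
move=> x; apply: continuous_comp; last exact: sqrt_continuous.
by apply: differentiable_continuous; have [+ _ _] := C2_on_sum_sqr openT; apply.
Qed.

Lemma enorm_ge0 x : 0 <= enorm x.
Proof. exact: sqrtr_ge0. Qed.

Lemma enorm_eq0 x : (enorm x == 0) = (x == 0).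
Proof.
rewrite /enorm sqrtr_eq0 le_eqVlt ltNge sum_sqr_ge0 orbF.
rewrite psumr_eq0 => [|i _]; last exact: sqr_ge0.
apply/allP/eqP => [x0|-> i _]; last by rewrite mxE expr0n eqxx.
apply/rowP => i; rewrite mxE; apply/eqP.
by have := x0 i (mem_index_enum _); rewrite /= sqrf_eq0.
Qed.

Lemma enorm_gt0 x : (0 < enorm x) = (x != 0).
Proof. by rewrite lt_neqAle enorm_ge0 andbT eq_sym enorm_eq0. Qed.

Lemma enormZ (k : R) x : enorm (k *: x) = `|k| * enorm x.
Proof.
rewrite /enorm -sqrtr_sqr -sqrtrM ?sqr_ge0 // mulr_sumr.
by congr Num.sqrt; apply: eq_bigr => i _; rewrite mxE exprMn.
Qed.

Lemma open_enorm (I : set R) : open I -> open [set x : 'rV[R]_N | I (enorm x)].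
Proof. by move=> oI; apply: open_comp => // x _; exact: enorm_continuous. Qed.

Lemma open_neq0_rV : open [set x : 'rV[R]_N | x != 0].
Proof.
rewrite (_ : mkset _ = [set x : 'rV[R]_N | [set r : R | 0 < r] (enorm x)]).
  exact/open_enorm/open_gt.
by apply/seteqP; split=> x /=; rewrite enorm_gt0.
Qed.

(** Off the origin the norm is the power 1/2 of a positive polynomial. *)
Lemma C2_on_enorm : C2_on [set x : 'rV[R]_N | x != 0] (@enorm R N).
Proof.
have oD := open_neq0_rV.
rewrite (_ : @enorm R N = fun x => (\sum_(i < N) x 0 i ^+ 2) `^ (2^-1)).
  apply: C2_on_powR => //; last exact: C2_on_sum_sqr.
  by move=> x /=; rewrite -enorm_gt0 sqrtr_gt0.
by apply/funext => x; rewrite powR12_sqrt //; exact: sum_sqr_ge0.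
Qed.

Lemma sproj_sphere x : x != 0 -> sphere (sproj x).
Proof.
move=> x0; rewrite /sphere /= enormZ ger0_norm ?invr_ge0 ?enorm_ge0 //.
by rewrite mulVf // enorm_eq0.
Qed.

Lemma sproj_id s : sphere s -> sproj s = s.
Proof. by rewrite /sphere /sproj /= => ->; rewrite invr1 scale1r. Qed.

Lemma sprojZ (k : R) x : 0 < k -> sproj (k *: x) = sproj x.
Proof.
move=> k0; rewrite /sproj enormZ gtr0_norm // scalerA invfM.
by rewrite mulrAC mulVf ?mul1r // gt_eqF.
Qed.

Lemma sphere_neq0 s : sphere s -> s != 0.
Proof. by rewrite /sphere /= -enorm_gt0 => ->. Qed.

End euclidean_norm.

(** * The sphere *)

Section sphere_laplacian_scaling.
Context {R : realType} {N : nat}.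
Implicit Types (w v : 'rV[R]_N -> R) (x s : 'rV[R]_N).

(** [w \o sproj] is homogeneous of degree 0, so its partial derivatives are homogeneous of degree
    -1. The identity turns the gradient composed with [sproj] into an explicit product,
    differentiable off the origin. *)
Lemma derive_sproj w (e x : 'rV[R]_N) : sphere_C2 w -> x != 0 ->
  'D_e (w \o @sproj R N) (sproj x) = enorm x * 'D_e (w \o @sproj R N) x.
Proof.
move=> [dw _ _] x0; have x_gt0 : 0 < enorm x by rewrite enorm_gt0.
have dL (z : 'rV[R]_N) : is_diff z ( *:%R (enorm x)^-1) ( *:%R (enorm x)^-1).
  exact: is_diff_scaler.
have dwx : differentiable (w \o @sproj R N) (sproj x).
  by apply/dw/sphere_neq0/sproj_sphere.
have homog : (w \o @sproj R N) \o *:%R (enorm x)^-1 = w \o @sproj R N.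
  by apply/funext => z /=; rewrite sprojZ // invr_gt0.
have := derive_comp_linear dL e dwx.
rewrite homog => ->; rewrite !deriveE // linearZ mulrA.
by rewrite divff ?mul1r // gt_eqF.
Qed.

(** [v] and [k * w] are compared on the sphere only, but after composition with [sproj] they agree
    on the open set of nonzero vectors, and so do their derivatives. *)
Lemma sphere_laplacianZ (k : R) w v : sphere_C2 w ->
  (forall s, sphere s -> v s = k * w s) ->
  forall s, sphere s -> sphere_laplacian v s = k * sphere_laplacian w s.
Proof.
move=> Cw vw s Ss; have [dw d2w _] := Cw; have oD := @open_neq0_rV R N.
have near_neq0 x : x != 0 -> \near x, x != 0.
  by move=> x0; apply: open_nbhs_nbhs.
have gradZ x i : x != 0 -> sphere_grad v x 0 i = k * sphere_grad w x 0 i.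
  move=> x0; rewrite !mxE -deriveMl; last exact/diff_derivable/dw.
  apply: near_eq_derive; near=> y => /=.
  by apply/vw/sproj_sphere; near: y; exact: near_neq0.
rewrite /sphere_laplacian /sphere_div mulr_sumr; apply: eq_bigr => i _.
have s0 := sphere_neq0 Ss.
rewrite -deriveMl.
  apply: near_eq_derive; near=> y.
  by apply/gradZ/sphere_neq0/sproj_sphere; near: y; exact: near_neq0.
(* To pull [k] out of the outer derivative, the gradient composed with [sproj] must be derivable;
   near [s] it is the product given by [derive_sproj]. *)
apply: (near_eq_derivable (f := @enorm R N * 'D_(delta_mx 0 i) (w \o @sproj R N))).
  near=> y; rewrite mxE derive_sproj //; near: y; exact: near_neq0.
apply/diff_derivable/differentiableM; last exact: d2w.
by have [+ _ _] := @C2_on_enorm R N; apply.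
Unshelve. all: by end_near. Qed.

End sphere_laplacian_scaling.

(** * Continuous functions whose modulus takes at most one nonzero value *)

Section two_valued.
Context {R : realType}.

Lemma continuous_zero_or_norm_const (f : R -> R) (x y K : R) : x <= y ->
  (forall t, x <= t <= y -> {for t, continuous f}) ->
  (forall t, x <= t <= y -> f t = 0 \/ `|f t| = K) -> f x = f y.
Proof.
move=> xy cf fK; apply/eqP/negPn/negP => /eqP fxy.
have cfw : {within `[x, y], continuous f}.
  apply: continuous_in_subspaceT => t; rewrite inE /= in_itv /=; exact: cf.
(* The endpoint values are distinct elements of {0, K, -K}; this weighted mean of
   them is not, whereas the midpoint could be 0. *)
have mid : Num.min (f x) (f y) <= (3 * f x + f y) / 4 <= Num.max (f x) (f y).
  by case: (ltrgtP (f x) (f y)) fxy => // h _; apply/andP; split; lra.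
have [t] := IVT xy cfw mid.
rewrite in_itv /= => /fK ft e; move: ft; rewrite e.
have := fK x; have := fK y; rewrite xy !lexx => /(_ isT) + /(_ isT).
have nE z : `|z| = K -> (z = K \/ z = - K) /\ 0 <= K.
  move=> <-; split=> //.
  by case: (ger0P z) => _; [left|right; rewrite opprK].
by case=> [|/nE[[|] ?]] ? [|/nE[[|] ?]] ? [|/nE[[|] ?]] ?; apply: fxy; lra.
Qed.

(** Two points that are not antipodal are joined by their chord projected to the sphere, which
    reduces the claim to an interval. Antipodal points are linked through a third point, which
    exists because [2 <= N]. *)
Lemma sphere_zero_or_norm_const (N : nat) (w : 'rV[R]_N -> R) (K : R) :
  (2 <= N)%N -> sphere_C2 w ->
  (forall s, sphere s -> w s = 0 \/ `|w s| = K) ->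
  forall s t, sphere s -> sphere t -> w s = w t.
Proof.
move=> hN [dw _ _] wK.
have seg s t : sphere s -> sphere t -> t != - s -> w s = w t.
  move=> Ss St ts; pose g (x : R) : 'rV[R]_N := (1 - x) *: s + x *: t.
  (* If the chord met the origin, comparing the norms of its two terms would give [x = 1/2], so that
     [s + t = 0]. *)
  have g0 x : 0 <= x <= 1 -> g x != 0.
    move=> /andP[x0 x1]; apply/negP => /eqP /[dup] gx.
    move=> /eqP; rewrite addr_eq0 => /eqP /(congr1 (@enorm R N)).
    rewrite -scaleNr !enormZ Ss St !mulr1 normrN !ger0_norm ?subr_ge0 // => e.
    move/negP: ts; apply; rewrite -addr_eq0 addrC.
    have xE : x = 2^-1 by lra.
    have : 2 *: g x = s + t.
      by rewrite /g scalerDr !scalerA xE; congr (_ + _);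
        rewrite -[RHS]scale1r; congr (_ *: _); lra.
    by rewrite gx scaler0 => <-.
  have cg x : {for x, continuous g}.
    apply: differentiable_continuous; apply: differentiableD.
      by apply: differentiableZl; apply: differentiableB.
    exact: differentiableZl.
  have := @continuous_zero_or_norm_const (w \o @sproj R N \o g) 0 1 K ler01.
  rewrite /= /g subr0 subrr !scale0r !scale1r addr0 add0r !sproj_id //; apply.
    move=> x x01; apply: continuous_comp; first exact: cg.
    by apply/differentiable_continuous/dw/g0.
  by move=> x x01; apply/wK/sproj_sphere/g0.
move=> s t Ss St; have [ts|] := eqVneq t (- s); last exact: seg.
have SN z : sphere z -> sphere (- z : 'rV[R]_N).
  by rewrite /sphere /= -scaleN1r enormZ normrN1 mul1r.
(* Such a [p] is antipodal neither to [s] nor to [- s], so [seg] applies to both pairs. *)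
suff [p [Sp ps pNs]] : exists p : 'rV[R]_N, [/\ sphere p, p != s & p != - s].
  rewrite (seg s p) // ts (seg (- s) p) ?opprK //; exact: SN.
have Se (i : 'I_N) : sphere (delta_mx 0 i : 'rV[R]_N).
  rewrite /sphere /= /enorm (bigD1 i) //= big1 => [|j ji].
    by rewrite mxE !eqxx expr1n addr0 sqrtr1.
  by rewrite mxE (negbTE ji) expr0n.
pose i0 := Ordinal (ltnW hN : (0 < N)%N); pose i1 := Ordinal hN.
(* Otherwise every basis vector is [s] or [- s]. Then each coordinate of [s] vanishes, by comparison
   with a basis vector of another index, one of [i0] and [i1]. *)
apply: contrapT => noP.
have pm i : delta_mx 0 i = s \/ delta_mx 0 i = - s.
  apply: contrapT => /not_orP[/eqP ne1 /eqP ne2]; apply: noP.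
  by exists (delta_mx 0 i).
have s0 (i j : 'I_N) : i != j -> s 0 j = 0.
  move=> ij; case: (pm i) => /rowP/(_ j); rewrite !mxE eq_sym (negbTE ij) //.
  by move=> /eqP; rewrite eq_sym oppr_eq0 => /eqP.
have : s = 0.
  apply/rowP => j; rewrite mxE.
  have [e|ne] := eqVneq i0 j; last exact: s0 ne.
  by apply: (s0 i1); rewrite -e.
by apply/eqP; exact: sphere_neq0.
Qed.

End two_valued.

(** * Separation of variables *)

Section signed_powers.
Context {R : realType}.
Implicit Types x y p q : R.

Lemma signed_powM q x y :
  signed_pow q (x * y) = signed_pow q x * signed_pow q y.
Proof. by rewrite /signed_pow normrM powRM // mulrACA. Qed.

Lemma powR_inj p x y : p != 0 -> 0 <= x -> 0 <= y ->
  x `^ p = y `^ p -> x = y.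
Proof.
move=> p0 x0 y0 /(congr1 (fun z => z `^ p^-1)).
by rewrite -!powRrM mulfV // !powRr1.
Qed.

(** The exponents multiply to -2. Thus [h = b^(2/(1-q))] is the positive function for which the
    coefficient [b^2 h^(q-1)] equals 1. *)
Lemma powR_conformal x q : 0 < x -> q != 1 ->
  (x `^ (2 / (1 - q))) `^ (q - 1) = (x ^+ 2)^-1.
Proof.
move=> x0 q1; have q10 : 1 - q != 0 by rewrite subr_eq0 eq_sym.
rewrite -powRrM (_ : _ * _ = - 2%:R); first by rewrite powR_invn // ltW.
by field.
Qed.

End signed_powers.

(** * Regularity and Laplacian of a product of a radial and an angular factor *)

Section product_solutions.
Context {R : realType} {N : nat}.
Implicit Types (I : set R) (h a b : R -> R) (w : 'rV[R]_N -> R)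
  (u : R -> 'rV[R]_N -> R).

(** This is [b^2] times the radial part of the Laplacian of the metric, written exactly as in
    [solves_radial_ode] so that it can be folded there. *)
Definition radial_op (c h : R -> R) (r : R) : R :=
  c r ^+ 2 * h^`(2)%classic r
  + (N%:R - 1) * c r * c^`()%classic r * h^`()%classic r.

Lemma C2_derivable1 I h r : C2_on (V := R^o) I h -> I r ->
  derivable h r 1 /\ derivable h^`()%classic r 1.
Proof.
move=> [d1 d2 _] Ir; split; first exact/diff_derivable/d1.
rewrite (_ : h^`()%classic = 'D_1 (h : R^o -> R)); last first.
  by apply/funext => x; rewrite derive1E.
exact/diff_derivable/d2.
Qed.

Lemma derive12_scale I h (g : R -> R) (k : R) : open I -> C2_on (V := R^o) I h ->
  (forall r, I r -> g r = k * h r) -> forall r, I r ->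
  g^`()%classic r = k * h^`()%classic r /\ g^`(2)%classic r = k * h^`(2)%classic r.
Proof.
move=> oI Ch gh.
have d1 r : I r -> g^`()%classic r = k * h^`()%classic r.
  move=> Ir; have [dh _] := C2_derivable1 Ch Ir.
  rewrite -derive1Ml // !derive1E; apply: near_eq_derive.
  by apply: (near_open oI) => // y; rewrite inE => /gh.
move=> r Ir; split; first exact: d1.
have [_ dh] := C2_derivable1 Ch Ir.
rewrite /derive1n /= -derive1Ml // derive1E [RHS]derive1E.
by apply: near_eq_derive; apply: (near_open oI) => // y; rewrite inE => /d1.
Qed.

Lemma radial_op_scale I h (g c : R -> R) (k : R) : open I ->
  C2_on (V := R^o) I h ->
  (forall r, I r -> g r = k * h r) -> forall r, I r ->
  radial_op c g r = k * radial_op c h r.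
Proof.
move=> oI Ch gh r Ir; have [e1 e2] := derive12_scale oI Ch gh Ir.
by rewrite /radial_op e1 e2; ring.
Qed.

Lemma metric_laplacian_product I a b h w u :
  open I -> C2_on (V := R^o) I h -> sphere_C2 w ->
  (forall r s, I r -> sphere s -> u r s = h r * w s) ->
  forall r s, I r -> sphere s ->
  metric_laplacian a b u r s =
    (b r ^+ 2)^-1 * (radial_op (fun t => b t / a t) h r * w s
                     + h r * sphere_laplacian w s).
Proof.
move=> oI Ch Cw uhw r s Ir Ss; rewrite /metric_laplacian.
rewrite (@sphere_laplacianZ _ _ (h r) w) //; last by move=> t St; exact: uhw.
have us t : I t -> (fun t => u t s) t = w s * h t.
  by move=> It; rewrite uhw // mulrC.
have [-> ->] := derive12_scale oI Ch us Ir.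
by rewrite /radial_op; ring.
Qed.

Lemma enorm_rayZ (s : 'rV[R]_N) (r : R) : sphere s -> 0 < r ->
  enorm (r *: s) = r /\ sproj (r *: s) = s.
Proof.
by move=> Ss r0; rewrite enormZ sprojZ // sproj_id // Ss mulr1 gtr0_norm.
Qed.

(** Along the ray through [s] the solution is [w s * h], and the nonzero constant [w s] can be
    divided out. *)
Lemma C2_on_radial_factor I u h w (s : 'rV[R]_N) : open I ->
  (forall r, I r -> 0 < r) -> cylinder_C2 I u ->
  (forall r s, I r -> sphere s -> u r s = h r * w s) ->
  sphere s -> w s != 0 -> C2_on (V := R^o) I h.
Proof.
move=> oI Ipos Cu uhw Ss ws.
have dL (r : R^o) : is_diff r ( *:%R ^~ s : R^o -> 'rV[R]_N) ( *:%R ^~ s).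
  exact: is_diff_scalel.
have := C2_on_comp_linear dL (open_enorm oI) Cu.
have IE : I `<=` ( *:%R ^~ s : R^o -> 'rV[R]_N) @^-1` [set x | I (enorm x)].
  by move=> r Ir /=; rewrite (enorm_rayZ Ss (Ipos _ Ir)).1.
move=> /(C2_on_subset IE) Cs.
have := C2_onM (oI : open (I : set R^o)) Cs (C2_on_cst _ (w s)^-1).
apply: eq_C2_on => // r; rewrite inE => Ir /=.
have [e1 e2] := enorm_rayZ Ss (Ipos _ Ir).
by rewrite fctE /= e1 e2 uhw // mulfK.
Qed.

(** On the region [I (enorm x)], [w \o sproj] is the quotient of [u] by [h]; homogeneity extends its
    regularity to all nonzero vectors. *)
Lemma sphere_C2_factor_gt0 I u h w : open I -> I !=set0 ->
  (forall r, I r -> 0 < r) -> cylinder_C2 I u ->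
  (forall r s, I r -> sphere s -> u r s = h r * w s) ->
  C2_on (V := R^o) I h -> (forall r, I r -> 0 < h r) -> sphere_C2 w.
Proof.
move=> oI [r0 Ir0] Ipos Cu uhw Ch h0.
pose D := [set x : 'rV[R]_N | I (enorm x)].
have oD : open D := open_enorm oI.
have Dn0 : D `<=` [set x | x != 0].
  by move=> x /Ipos; rewrite enorm_gt0.
have hD : C2_on D (h \o @enorm R N).
  exact: (C2_on_comp oD _ Ch (C2_on_subset Dn0 (@C2_on_enorm R N))).
have CwD : C2_on D (w \o @sproj R N).
  (* The reciprocal of [h] is taken as a power with exponent -1, which is where the positivity of
     [h] enters. *)
  have hinv := C2_on_powR (-1) oD (fun x Dx => h0 _ Dx) hD.
  apply: (eq_C2_on oD _ (C2_onM oD Cu hinv)) => x; rewrite inE => Dx.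
  have x0 := Dn0 _ Dx; have hx0 := h0 _ Dx.
  rewrite fctE /= uhw //; last exact: sproj_sphere.
  by rewrite powR_inv1 ?ltW // mulrAC divff ?mul1r // gt_eqF.
(* w \o sproj is homogeneous of degree 0, hence equal to its composition with the
   dilation that sends x into the region where u / h is defined. *)
apply: C2_on_local => x /= x0.
have x_gt0 : 0 < enorm x by rewrite enorm_gt0.
have k0 : 0 < r0 / enorm x by rewrite divr_gt0 // Ipos.
have dL (z : 'rV[R]_N) : is_diff z ( *:%R (r0 / enorm x)) ( *:%R (r0 / enorm x)).
  exact: is_diff_scaler.
exists ( *:%R (r0 / enorm x) @^-1` D).
  by rewrite /D /= enormZ gtr0_norm // divfK // gt_eqF.
have := C2_on_comp_linear dL oD CwD.
by congr C2_on; apply/funext => z /=; rewrite sprojZ.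
Qed.

Lemma sphere_C2Z (k : R) w : sphere_C2 w -> sphere_C2 (fun s => k * w s).
Proof.
move=> Cw; have := C2_onM (@open_neq0_rV R N) (C2_on_cst _ k) Cw.
exact.
Qed.

Lemma sphere_C2_factor I u h w (r0 : R) : open I ->
  (forall r, I r -> 0 < r) -> cylinder_C2 I u ->
  (forall r s, I r -> sphere s -> u r s = h r * w s) ->
  C2_on (V := R^o) I h -> I r0 -> h r0 != 0 -> sphere_C2 w.
Proof.
move=> oI Ipos Cu uhw Ch Ir0 h0.
(* [J] is the set where [h] has the sign of [h r0]. There [u] is the product of the positive factor
   [h r * h r0] and the angular factor [w s / h r0]. *)
pose J := [set r | I r /\ 0 < h r * h r0].
have ch r : I r -> {for r, continuous h}.
  by move=> Ir; have [dh _ _] := Ch; exact/differentiable_continuous/dh.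
have oJ : open J.
  rewrite openE => r [Ir hr]; apply: filterI; first exact: open_nbhs_nbhs.
  have : {for r, continuous (fun t => h t * h r0)}.
    by apply: continuousM; [exact: ch|exact: cst_continuous].
  by move=> /cvgr_gt; apply.
have JI : J `<=` I by move=> r [].
have CwI : sphere_C2 (fun s => (h r0)^-1 * w s).
  apply: (@sphere_C2_factor_gt0 J u (fun r => h r * h r0)) => //.
  - by exists r0; split=> //; rewrite -expr2 exprn_even_gt0.
  - by move=> r [/Ipos].
  - by apply: C2_on_subset Cu => x [].
  - by move=> r s [Ir _] Ss; rewrite uhw // mulrA mulfK.
  - apply: (C2_onM (oJ : open (J : set R^o)) (C2_on_subset JI Ch)).
    exact: C2_on_cst.
  - by move=> r [].
have := sphere_C2Z (h r0) CwI.
by congr sphere_C2; apply/funext => s; rewrite mulVKf.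
Qed.

End product_solutions.

(** * Rigidity of the two factors, and the converse construction *)

Section separation.
Context {R : realType} {N : nat}.
Variables (hN : (2 <= N)%N) (I : set R) (oI : open I) (Iint : is_interval I).
Hypothesis Ipos : forall r, I r -> 0 < r.
Variables (a b : R -> R).
Hypothesis b_gt0 : forall r, I r -> 0 < b r.
Hypothesis db : forall r, I r -> derivable b r 1.
Variables (eps q : R).
Hypothesis eps_neq0 : eps != 0.
Hypothesis q_neq1 : q != 1.

Let c := fun r => b r / a r.
Let phi := fun r => b r `^ (2 / (1 - q)).

Lemma phi_gt0 r : I r -> 0 < phi r.
Proof. by move=> Ir; rewrite powR_gt0 // b_gt0. Qed.

(** Since [b^2 phi^(q-1) = 1], the weight [b^2] cancels and the equation for [phi * w] loses its
    dependence on [r]. *)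
Lemma signed_pow_phi r : I r -> b r ^+ 2 * signed_pow q (phi r) = phi r.
Proof.
move=> Ir; have b0 := b_gt0 Ir.
rewrite /signed_pow gtr0_norm ?phi_gt0 // powR_conformal //.
by rewrite mulrCA divff ?mulr1 // expf_neq0 // gt_eqF.
Qed.

Lemma phi_continuous r : I r -> {for r, continuous phi}.
Proof.
move=> Ir; apply: (@continuous_comp _ _ _ b (fun x => x `^ (2 / (1 - q)))).
  exact/differentiable_continuous/derivable1_diffP/db.
exact/differentiable_continuous/differentiable_powR/b_gt0.
Qed.

Lemma segment_const (f : R -> R) (K : R) :
  (forall r, I r -> {for r, continuous f}) ->
  (forall r, I r -> f r = 0 \/ `|f r| = K) ->
  forall r t, I r -> I t -> f r = f t.
Proof.
move=> cf fK r t Ir It; wlog rt : r t Ir It / r <= t.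
  by case: (leP r t) => [|/ltW] rt wl; [exact: wl|apply/esym/wl].
by apply: (@continuous_zero_or_norm_const _ f _ _ K rt) => z zrt;
  [apply: cf|apply: fK]; exact: Iint zrt.
Qed.

Section product.
Variables (u : R -> 'rV[R]_N -> R) (h : R -> R) (w : 'rV[R]_N -> R).
Hypothesis uE : solves_E I a b eps q u.
Hypothesis uhw : forall r s, I r -> sphere s -> u r s = h r * w s.

Section regular.
Hypotheses (Ch : C2_on (V := R^o) I h) (Cw : sphere_C2 w).

Lemma separated_eq r s : I r -> sphere s ->
  radial_op (N := N) c h r * w s + h r * sphere_laplacian w s
  = eps * (b r ^+ 2 * signed_pow q (h r)) * signed_pow q (w s).
Proof.
move=> Ir Ss; have [_ /(_ r s Ir Ss)] := uE.
rewrite (metric_laplacian_product _ _ oI Ch Cw uhw) // uhw // signed_powM.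
have b20 : b r ^+ 2 != 0 by rewrite expf_neq0 // gt_eqF // b_gt0.
by move=> /(congr1 ( *%R (b r ^+ 2))); rewrite mulVKf // => ->; ring.
Qed.

Hypothesis wnc : nonconstant_on_sphere w.

(* Two radii with different coefficients would force [|w|^(q-1)] to be
   constant where [w] does not vanish, hence [w] to be constant. *)
Lemma separation_constants r r' : I r -> I r' -> h r != 0 -> h r' != 0 ->
  b r ^+ 2 * `|h r| `^ (q - 1) = b r' ^+ 2 * `|h r'| `^ (q - 1) /\
  radial_op (N := N) c h r / h r = radial_op (N := N) c h r' / h r'.
Proof.
move=> Ir Ir' h0 h'0; have [s [t [Ss St wst]]] := wnc.
have [s1 Ss1 ws1] : exists2 s1, sphere s1 & w s1 != 0.
  by have [ws0|ws0] := eqVneq (w s) 0; [exists t; rewrite // -ws0 eq_sym|exists s].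
(* The left side does not involve [x], so the right sides at [r] and [r'] can be subtracted, which
   gives [key]. *)
have divided x z : I x -> sphere z -> h x != 0 ->
    sphere_laplacian w z = eps * (b x ^+ 2 * `|h x| `^ (q - 1)) * signed_pow q (w z)
      - radial_op (N := N) c h x / h x * w z.
  move=> Ix Sz hx; have := separated_eq Ix Sz.
  rewrite [signed_pow q (h x)]/signed_pow => e; apply: (mulfI hx).
  by apply: (addrI (radial_op (N := N) c h x * w z)); rewrite e; field.
set A := b r ^+ 2 * _; set A' := b r' ^+ 2 * _.
set B := _ / h r; set B' := _ / h r'.
have key z : sphere z -> eps * (A - A') * signed_pow q (w z) = (B - B') * w z.
  move=> Sz; have := divided _ _ Ir Sz h0; rewrite (divided _ _ Ir' Sz h'0).
  by rewrite -/A -/A' -/B -/B' => e; lra.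
have AA' : A = A'.
  apply/eqP; rewrite -subr_eq0; apply/negPn/negP => dA.
  have powK z : sphere z -> w z != 0 ->
      `|w z| `^ (q - 1) = (B - B') / (eps * (A - A')).
    move=> Sz wz; have := key z Sz; rewrite /signed_pow => e.
    apply: (mulfI wz); apply: (mulfI (mulf_neq0 eps_neq0 dA)); rewrite e.
    by field; rewrite eps_neq0 dA.
  have wK z : sphere z -> w z = 0 \/ `|w z| = `|w s1|.
    move=> Sz; have [->|wz] := eqVneq (w z) 0; [by left|right].
    (* Since [q != 1], equal powers of exponent [q - 1] give equal moduli; the common modulus is the
       one at [s1]. *)
    apply: (@powR_inj _ (q - 1)); rewrite ?subr_eq0 //.
    by rewrite !powK.
  by move/eqP: wst; apply; exact: (sphere_zero_or_norm_const hN Cw wK).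
(* Once [A = A'], the identity [key] at a point where [w] is nonzero leaves [B = B']. *)
split=> //; have := key s1 Ss1; rewrite AA' subrr mulr0 mul0r => /esym/eqP.
by rewrite mulf_eq0 (negbTE ws1) orbF subr_eq0 => /eqP.
Qed.

(** The quotient [h / phi] is continuous on [I], and its modulus is constant where [h] is nonzero.
    Zeros of [h] are not excluded in advance: the value 0 is allowed in [segment_const], which makes
    the quotient equal to its nonzero value at [r0]. *)
Lemma radial_factor_eq r0 : I r0 -> h r0 != 0 ->
  forall r, I r -> h r = h r0 / phi r0 * phi r.
Proof.
move=> Ir0 h0 r Ir; have p0 x (Ix : I x) : phi x != 0 by rewrite gt_eqF ?phi_gt0.
rewrite -(segment_const (f := fun x => h x / phi x) (K := `|h r0 / phi r0|) _ _ Ir Ir0).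
- by rewrite divfK ?p0.
- move=> x Ix; apply: continuousM.
    by have [dh _ _] := Ch; exact/differentiable_continuous/dh.
  by apply: continuousV; [exact: p0|exact: phi_continuous].
move=> x Ix; have [->|hx] := eqVneq (h x) 0; [by left; rewrite mul0r|right].
(* The coefficient [b^2 |h|^(q-1)] is a power of [|h / phi|], because [phi^(q-1)] is the inverse of
   [b^2]. *)
have powE z : I z -> `|h z / phi z| `^ (q - 1) = b z ^+ 2 * `|h z| `^ (q - 1).
  move=> Iz; have pz := phi_gt0 Iz.
  rewrite normrM powRM // normfV (gtr0_norm pz) mulrC; congr (_ * _).
  rewrite -powR_inv1 ?ltW // -powRrM mulN1r powRN powR_conformal ?b_gt0 //.
  by rewrite invrK.
have q0 : q - 1 != 0 by rewrite subr_eq0.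
apply: (powR_inj q0 (normr_ge0 _) (normr_ge0 _)).
rewrite powE // powE //.
by have [] := separation_constants Ix Ir0 hx h0.
Qed.

End regular.

(** Writing [h = k phi] with [k] constant, the factor [k] is absorbed into the angular part: [w'] is
    [k * w]. *)
Lemma separated_solution : ~ radial I u ->
  exists mu (w' : 'rV[R]_N -> R),
    [/\ solves_radial_ode N I c mu phi, solves_sphere eps q mu w',
        nonconstant_on_sphere w'
      & forall r s, I r -> sphere s -> u r s = phi r * w' s].
Proof.
move=> unr.
have [r0 [s [t [Ir0 Ss St ust]]]] : exists r s t,
    [/\ I r, sphere s, sphere t & u r s != u r t].
  apply: contrapT => no; apply: unr => r s t Ir Ss St.
  by apply: contrapT => /eqP ne; apply: no; exists r, s, t.
rewrite !uhw // in ust.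
have h0 : h r0 != 0 by apply: contraNneq ust => ->; rewrite !mul0r.
have wst : w s != w t by apply: contraNneq ust => ->.
have wnc : nonconstant_on_sphere w by exists s, t.
have [s1 Ss1 ws1] : exists2 s1, sphere s1 & w s1 != 0.
  by have [ws0|ws0] := eqVneq (w s) 0; [exists t; rewrite // -ws0 eq_sym|exists s].
have [Cu _] := uE.
have Ch := C2_on_radial_factor oI Ipos Cu uhw Ss1 ws1.
have Cw := sphere_C2_factor oI Ipos Cu uhw Ch Ir0 h0.
have hphi := radial_factor_eq Ch Cw wnc Ir0 h0.
set k := h r0 / phi r0 in hphi.
have k0 : k != 0 by rewrite mulf_neq0 // invr_eq0 gt_eqF // phi_gt0.
have phih r : I r -> phi r = k^-1 * h r by move=> Ir; rewrite hphi // mulKf.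
(* As [b] is only assumed differentiable, the C^2 regularity of [phi] is inherited from the
   solution, through [h]. *)
have Cphi : C2_on (V := R^o) I phi.
  apply: (eq_C2_on (oI : open (I : set R^o)) _
    (C2_onM (oI : open (I : set R^o)) (C2_on_cst _ k^-1) Ch)) => r.
  by rewrite inE fctE => Ir; rewrite phih.
have Ckw := sphere_C2Z k Cw.
have ukw r z : I r -> sphere z -> u r z = phi r * (k * w z).
  by move=> Ir Sz; rewrite uhw // hphi // mulrAC mulrC.
pose mu := radial_op (N := N) c h r0 / h r0.
have ode : solves_radial_ode N I c mu phi.
  split=> // r Ir; rewrite -/(radial_op (N := N) c phi r).
  rewrite (radial_op_scale _ oI Ch phih Ir).
  have hr : h r != 0 by rewrite hphi // mulf_neq0 // gt_eqF // phi_gt0.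
  have [_ e] := separation_constants Ch Cw wnc Ir Ir0 hr h0.
  by rewrite /mu -e phih //; field; rewrite k0 hr.
(* The equation on the sphere is the equation for [u] at the single radius [r0], multiplied by [b^2]
   and divided by [phi r0]. *)
exists mu, (fun z => k * w z); split=> //.
  split=> // z Sz; have p0 : phi r0 != 0 by rewrite gt_eqF // phi_gt0.
  have [_ /(_ r0 z Ir0 Sz)] := uE.
  rewrite (metric_laplacian_product _ _ oI Cphi Ckw ukw) // ukw // signed_powM.
  have [_ /(_ r0 Ir0)] := ode; rewrite -/(radial_op (N := N) c phi r0) => ->.
  have b20 : b r0 ^+ 2 != 0 by rewrite expf_neq0 // gt_eqF // b_gt0.
  move=> /(congr1 ( *%R (b r0 ^+ 2))); rewrite mulVKf // => e.
  apply: (mulfI p0); rewrite -[in RHS](signed_pow_phi Ir0).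
  have -> : b r0 ^+ 2 * signed_pow q (phi r0) * (eps * signed_pow q (k * w z))
    = b r0 ^+ 2 * (eps * (signed_pow q (phi r0) * signed_pow q (k * w z))) by ring.
  by rewrite -e; ring.
by exists s, t; split=> //; rewrite (inj_eq (mulfI k0)).
Qed.

End product.

Lemma product_solves mu (w : 'rV[R]_N -> R) :
  solves_radial_ode N I c mu phi -> solves_sphere eps q mu w ->
  solves_E I a b eps q (fun r s => phi r * w s).
Proof.
move=> [Cphi ode] [Cw eqw]; split.
  have Dn0 : [set x | I (enorm x)] `<=` [set x : 'rV[R]_N | x != 0].
    by move=> x /Ipos; rewrite enorm_gt0.
  have oD := @open_enorm R N I oI.
  have CphiD := C2_on_comp oD (fun x (Dx : I (enorm x)) => Dx) Cphi
    (C2_on_subset Dn0 (@C2_on_enorm R N)).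
  have := C2_onM oD CphiD (C2_on_subset Dn0 Cw).
  exact.
move=> r s Ir Ss.
rewrite (@metric_laplacian_product _ _ I a b phi w) //.
have := ode r Ir; rewrite -/(radial_op (N := N) c phi r) => ->.
have b0 : b r != 0 by rewrite gt_eqF // b_gt0.
rewrite (_ : _ + _ = phi r * (sphere_laplacian w s + mu * w s)); last by ring.
(* Writing the leading [phi r] as [b^2 phi^q] cancels the factor [1 / b^2] of the Laplacian. *)
rewrite eqw // signed_powM -{1}(signed_pow_phi Ir).
by field.
Qed.

End separation.

Unset Implicit Arguments.

Theorem theorem1 (R : realType) (N : nat) (hN : (2 <= N)%N)
    (I : set R) (hIopen : open I) (hIint : is_interval I) (hI0 : I !=set0)
    (hIpos : forall r, I r -> 0 < r)
    (a b : R -> R)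
    (ha : forall r, I r -> 0 < a r) (hb : forall r, I r -> 0 < b r)
    (hda : forall r, I r -> derivable a r 1)
    (hdb : forall r, I r -> derivable b r 1)
    (eps : R) (heps : eps = 1 \/ eps = -1)
    (q : R) (hq0 : 0 < q) (hq1 : q != 1) :
  let c := fun r => b r / a r in
  let phi := fun r => b r `^ (2 / (1 - q)) in
  ((exists u : R -> 'rV[R]_N -> R,
      [/\ solves_E I a b eps q u, pseudo_radial I u & ~ radial I u])
   <->
   (exists mu : R,
      solves_radial_ode N I c mu phi /\
      exists w : 'rV[R]_N -> R,
        solves_sphere eps q mu w /\ nonconstant_on_sphere w))
  /\
  (forall mu : R,
     solves_radial_ode N I c mu phi ->
     (exists w : 'rV[R]_N -> R,
        solves_sphere eps q mu w /\ nonconstant_on_sphere w) ->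
     forall u : R -> 'rV[R]_N -> R,
       solves_E I a b eps q u -> pseudo_radial I u -> ~ radial I u ->
       exists w : 'rV[R]_N -> R,
         [/\ solves_sphere eps q mu w, nonconstant_on_sphere w
           & forall r s, I r -> sphere s -> u r s = phi r * w s]).
Proof.
move=> c phi.
have eps0 : eps != 0 by case: heps => ->; rewrite ?oppr_eq0 oner_neq0.
have sep u : solves_E I a b eps q u -> pseudo_radial I u -> ~ radial I u ->
    exists mu (w : 'rV[R]_N -> R),
      [/\ solves_radial_ode N I c mu phi, solves_sphere eps q mu w,
          nonconstant_on_sphere w
        & forall r s, I r -> sphere s -> u r s = phi r * w s].
  move=> uE [h [w uhw]].
  exact: (separated_solution hN hIopen hIint hIpos hb hdb eps0 hq1 uE uhw).
split; [split|].
- move=> [u [uE upr unr]]; have [mu [w [ode eqw wnc _]]] := sep u uE upr unr.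
  by exists mu; split=> //; exists w.
- move=> [mu [ode [w [eqw [s [t [Ss St wst]]]]]]].
  exists (fun r s => phi r * w s); split.
  + exact: (product_solves hIopen hIpos hb hq1 ode eqw).
  + by exists phi, w.
  + have [r Ir] := hI0; move=> /(_ r s t Ir Ss St).
    have p0 : phi r != 0 by rewrite gt_eqF // powR_gt0 // hb.
    by move=> /(mulfI p0)/eqP; rewrite (negbTE wst).
move=> mu ode _ u uE upr unr.
have [mu' [w [ode' eqw wnc uw]]] := sep u uE upr unr.
(* The radial equation determines its constant: at a point of [I], [mu * phi] and [mu' * phi] both
   equal its left side, and [phi] is nonzero. *)
suff -> : mu = mu' by exists w.
have [r Ir] := hI0.
have p0 : phi r != 0 by rewrite gt_eqF // powR_gt0 // hb.
by apply: (mulIf p0); rewrite -(ode.2 r Ir) -(ode'.2 r Ir).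
Qed.
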